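(* Let $P_1$ be the Cantor distribution satisfying $P_1=\frac12P_1\circ S_1^{-1}+\frac12P_1\circ S_2^{-1}$ with $S_1(x)=\frac13x$, $S_2(x)=\frac13x+\frac29$, let $P_2$ be the Cantor distribution satisfying $P_2=\frac12P_2\circ T_1^{-1}+\frac12P_2\circ T_2^{-1}$ with $T_1(x)=\frac14x+\frac12$, $T_2(x)=\frac14x+\frac34$, and let $P=\frac12P_1+\frac12P_2$. Then the quantization coefficient for $P$ does not exist; that is, with $\beta_1=\frac{\log2}{\log3}$ (the quantization dimension of $P$), the sequence $\left(n^{2/\beta_1}V_n(P)\right)_{n\ge1}$ does not converge.
   Context: $P_1$ and $P_2$ are the unique Borel probability measures on $\mathbb R$ satisfying the stated self-similarity relations. For a Borel probability measure $Q$ on $\mathbb R$ with finite second moment, the $n$th quantization error is $V_n(Q)=\inf\{\int\min_{a\in\alpha}(x-a)^2\,dQ(x):\alpha\subset\mathbb R,\ 1\le\mathrm{card}(\alpha)\le n\}$. The quantization dimension of $Q$ is $D(Q)=\lim_{n\to\infty}\frac{2\log n}{-\log V_n(Q)}$, when this limit exists. The $s$-dimensional lower and upper quantization coefficients of $Q$ are $\liminf_n n^{2/s}V_n(Q)$ and $\limsup_n n^{2/s}V_n(Q)$; the quantization coefficient exists if, for $s=D(Q)$, these two agree. *)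

(* Defs.v *)
From mathcomp Require Import all_boot all_order all_algebra finmap.
From mathcomp Require Import all_classical all_reals all_analysis.
Import Order.TTheory GRing.Theory Num.Theory numFieldNormedType.Exports.

Set Implicit Arguments.
Unset Strict Implicit.
Unset Printing Implicit Defensive.

Local Open Scope classical_set_scope.
Local Open Scope ring_scope.

Definition borel_probability (R : realType) := probability (measurableTypeR R) R.

(* [Q = 1/2 Q1 + 1/2 Q2] on Borel sets. *)
Definition half_mixture (R : realType)
    (Q Q1 Q2 : set (measurableTypeR R) -> \bar R) : Prop :=
  forall A : set (measurableTypeR R), measurable A ->
    Q A = ((2^-1)%:E * Q1 A + (2^-1)%:E * Q2 A)%E.

Definition self_similar (R : realType) (f g : R -> R)
    (Q : borel_probability R) : Prop :=
  half_mixture Q (pushforward Q (f : measurableTypeR R -> measurableTypeR R))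
                 (pushforward Q (g : measurableTypeR R -> measurableTypeR R)).

(* The default value [+oo] is the neutral element of [mine], so for a nonempty
   [alpha] the iterated [mine] is the minimum over [alpha]. *)
Definition distortion (R : realType) (Q : borel_probability R)
    (alpha : {fset R}) : \bar R :=
  (\int[Q]_x \big[mine/+oo]_(a <- alpha) ((x - a) ^+ 2)%:E)%E.

(* Extended-real valued; finite for [n >= 1] when [Q] has a finite second
   moment. *)
Definition quantization_error (R : realType) (Q : borel_probability R)
    (n : nat) : \bar R :=
  ereal_inf [set distortion Q alpha
            | alpha in [set alpha : {fset R} | (1 <= #|` alpha| <= n)%N]].

Definition has_quantization_dimension (R : realType)
    (Q : borel_probability R) (s : R) : Prop :=
  (fun n : nat => 2 * ln n%:R / - ln (fine (quantization_error Q n)))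
    @ \oo --> s.

(* Indexed from [n = 0]; the spurious term affects neither the lower and upper
   limits nor convergence. *)
Definition scaled_quantization_error (R : realType)
    (Q : borel_probability R) (s : R) (n : nat) : \bar R :=
  ((n%:R `^ (2 / s))%:E * quantization_error Q n)%E.

Definition lower_quantization_coefficient (R : realType)
    (Q : borel_probability R) (s : R) : \bar R :=
  limn_einf (scaled_quantization_error Q s).

Definition upper_quantization_coefficient (R : realType)
    (Q : borel_probability R) (s : R) : \bar R :=
  limn_esup (scaled_quantization_error Q s).

Definition quantization_coefficient_exists (R : realType)
    (Q : borel_probability R) : Prop :=
  exists2 s : R, has_quantization_dimension Q s &
    lower_quantization_coefficient Q s = upper_quantization_coefficient Q s.

(* Main.v *)
(* Write V_n for the quantization errors. Since the second component contracts
   by 1/4, sending it 2^(9i) of 2^(10i) + 2^(9i) points makes its contribution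
   negligible, and putting the other 2^(10i) points at the images of the mean
   1/6 of P1 gives a scaled error tending to Var(P1)/2 = 1/144 along this
   sequence. In the other direction, discard the second component. If the
   points number n, the level-k cylinders of P1 have disjoint neighbourhoods
   N_w of half a cylinder length, and a cylinder whose N_w contains c points
   costs at least a constant multiple of 2 - c; summing over the 2^k cylinders
   yields V_n >= const 9^-k (2 - n/2^k). At n = 3 * 2^(k-1) the factor
   (3/2)^(2/beta1) >= 3 pushes the scaled error above 1/135 > 1/144, while at
   general n these bounds give the exact order n^(-2/beta1) of V_n. *)
From HB Require Import structures.
Require Import Defs.
From mathcomp Require Import all_boot all_order all_algebra finmap.
From mathcomp Require Import all_classical all_reals all_analysis.
From mathcomp Require Import measurable_realfun ring lra.
Import Order.TTheory GRing.Theory Num.Theory numFieldNormedType.Exports.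

Set Implicit Arguments.
Unset Strict Implicit.
Unset Printing Implicit Defensive.

Local Open Scope classical_set_scope.
Local Open Scope ring_scope.

(** * Integration against mixtures, and supports of self-similar measures *)

Lemma half_mixture_integral (R : realType) (Q : borel_probability R)
    (mu1 mu2 : {measure set (measurableTypeR R) -> \bar R})
    (F : measurableTypeR R -> \bar R) :
  half_mixture Q mu1 mu2 ->
  measurable_fun [set: measurableTypeR R] F -> (forall x, 0 <= F x)%E ->
  (\int[Q]_x F x =
   (2^-1)%:E * \int[mu1]_x F x + (2^-1)%:E * \int[mu2]_x F x)%E.
Proof.
move=> h mF F0; have h0 : 0 <= 2^-1 :> R by rewrite invr_ge0.
pose k := NngNum h0.
transitivity (\int[measure_add (mscale k mu1) (mscale k mu2)]_x F x)%E.
  apply: eq_measure_integral => A mA _; apply: (etrans (h A mA)).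
  exact/esym/measure_addE.
by rewrite ge0_integral_measure_add// !ge0_integral_mscale.
Qed.

(** Named so that it can carry the structure of a measurable function, which makes its pushforward a
    measure. *)
Definition affine (R : realType) (r b : R) :
  measurableTypeR R -> measurableTypeR R := fun x => r * x + b.

Lemma measurable_affine (R : realType) (r b : R) :
  measurable_fun [set: measurableTypeR R] (affine r b).
Proof. by apply: measurable_funD => //; exact: measurable_funM. Qed.

HB.instance Definition _ (R : realType) (r b : R) :=
  isMeasurableFun.Build _ _ _ _ (affine r b) (measurable_affine r b).

Lemma self_similar_integral (R : realType) (r b c : R)
    (Q : borel_probability R) (F : measurableTypeR R -> \bar R) :
  self_similar (affine r b) (affine r c) Q ->
  measurable_fun [set: measurableTypeR R] F -> (forall x, 0 <= F x)%E ->
  (\int[Q]_x F x = (2^-1)%:E * \int[Q]_x F (affine r b x)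
                 + (2^-1)%:E * \int[Q]_x F (affine r c x))%E.
Proof.
move=> h mF F0.
rewrite (@half_mixture_integral _ _ (distribution Q (affine r b))
  (distribution Q (affine r c)))//.
by rewrite !ge0_integral_pushforward.
Qed.

(* [r^-1] expands the exterior of [lo, hi] past any bound, while invariance
   makes the mass outside the [t]-neighbourhood at most that outside the
   [t/r]-neighbourhood. *)
Lemma self_similar_support (R : realType) (r b c lo hi : R)
    (Q : borel_probability R) :
  0 < r < 1 -> self_similar (affine r b) (affine r c) Q ->
  lo <= affine r b lo -> lo <= affine r c lo ->
  affine r b hi <= hi -> affine r c hi <= hi ->
  {ae Q, forall x, lo <= x <= hi}.
Proof.
move=> /andP[r0 r1] h lob loc hib hic.
pose A (t : R) : set (measurableTypeR R) := ~` `[lo - t, hi + t]%classic.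
have mA t : measurable (A t) by apply: measurableC; exact: measurable_itv.
have AS t : (Q (A t) <= Q (A (t / r)%R))%E.
  rewrite h// /pushforward.
  have sub d : lo <= affine r d lo -> affine r d hi <= hi ->
      (Q (affine r d @^-1` A t) <= Q (A (t / r)%R))%E.
    move=> lod hid; apply: le_measure; rewrite ?inE//.
      rewrite -[X in measurable X]setTI.
      by apply: (measurable_affine r d) => //; exact: mA.
    move=> x; rewrite /A /= !in_itv/= => /negP H; apply/negP; move: H.
    apply: contra => /andP[H1 H2].
    have e : t = r * (t / r) by rewrite mulrCA divff ?mulr1// gt_eqF.
    move: lod hid H1 H2; rewrite /affine; set s := t / r in e *.
    by rewrite e => *; apply/andP; split; nra.
  have := leeD (sub b lob hib) (sub c loc hic).
  move=> H; rewrite -ge0_muleDr//.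
  apply: (le_trans (lee_wpmul2l _ H)); first by rewrite lee_fin invr_ge0.
  have Qf : Q (A (t / r)) \is a fin_num by exact: fin_num_measure.
  by rewrite -(fineK Qf) -EFinD -EFinM lee_fin; lra.
have A0 t : 0 < t -> Q (A t) = 0%E.
  move=> t0.
  have le n : (Q (A t) <= Q (A (t / r ^+ n)%R))%E.
    elim: n => [|n IH]; first by rewrite expr0 divr1.
    apply: (le_trans IH); apply: (le_trans (AS _)).
    by rewrite exprSr invfM mulrA.
  have cv : Q (A (t / r ^+ n)) @[n --> \oo] --> Q (\bigcap_n A (t / r ^+ n)).
    apply: (@nonincreasing_cvg_mu _ _ _ Q (fun n => A (t / r ^+ n))) => //.
    - by apply: (le_lt_trans (probability_le1 _ _)) => //; rewrite ltry.
    - exact: bigcap_measurable.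
    move=> m n mn; apply/subsetPset => x; rewrite /A /= !in_itv/= => /negP H.
    apply/negP; apply: contra H => /andP[H1 H2].
    have : t / r ^+ m <= t / r ^+ n.
      rewrite ler_pM2l// lef_pV2 ?posrE ?exprn_gt0//.
      by rewrite ler_wiXn2l// ltW.
    by move=> ?; apply/andP; split; lra.
  have b0 : \bigcap_n A (t / r ^+ n) = set0.
    rewrite -subset0 => x /= Ax.
    pose M := `|lo - x| + `|x - hi| + 1.
    have M0 : 0 < M by rewrite ltr_wpDl// addr_ge0.
    have r1' : `|r| < 1 by rewrite ger0_norm// ltW.
    have /cvgrPdist_lt/(_ _ (divr_gt0 t0 M0))[N _ /(_ N (leqnn _))]/= :=
      cvg_expr r1'.
    rewrite sub0r normrN ger0_norm ?exprn_ge0 ?ltW// ltr_pdivlMr// => HN.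
    have rN : 0 < r ^+ N by rewrite exprn_gt0.
    have {}HN : M < t / r ^+ N by rewrite ltr_pdivlMr// mulrC.
    have := Ax N I; rewrite /A /= in_itv/=; apply; apply/andP.
    have := ler_norm (lo - x); have := ler_norm (x - hi).
    have := normr_ge0 (lo - x); have := normr_ge0 (x - hi).
    by move: HN; rewrite /M => *; split; lra.
  rewrite b0 measure0 in cv; apply/eqP; rewrite eq_le measure_ge0 andbT.
  by apply: (cvge_ge _ cv); near=> n; exact: le.
(* A point outside [[lo, hi]] is farther than some [1 / (k + 1)] from it, so countably many null
   sets suffice. *)
have nA : Q.-negligible (\bigcup_k A k.+1%:R^-1).
  apply: negligible_bigcup => k; exists (A k.+1%:R^-1); split => //.
  by apply: A0; rewrite invr_gt0.
apply: negligibleS nA => x /= /negP; rewrite negb_and -!ltNge.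
move=> /orP[] /ltr_add_invr[k]; set e := _^-1 => Hk; exists k => //;
  by rewrite /A /= in_itv/= -/e => /andP[? ?]; lra.
Unshelve. all: by end_near.
Qed.

(** * Mean cost of a list of points under affine maps *)

(** The integrand of [distortion], over sequences instead of finite sets, so that images and
    concatenations need no removal of duplicates. *)
Definition cost (R : realType) (s : seq R) (x : R) : \bar R :=
  \big[mine/+oo%E]_(a <- s) ((x - a) ^+ 2)%:E.

Lemma cost_cons (R : realType) (a : R) (s : seq R) (x : R) :
  cost (a :: s) x = mine ((x - a) ^+ 2)%:E (cost s x).
Proof. by rewrite /cost big_cons. Qed.

Lemma cost_ge (R : realType) (s : seq R) (x : R) (d : \bar R) :
  (forall a, a \in s -> (d <= ((x - a) ^+ 2)%:E)%E) -> (d <= cost s x)%E.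
Proof.
elim: s => [|a s IH] H; first by rewrite /cost big_nil leey.
rewrite cost_cons le_min H ?mem_head// IH// => y ys.
by rewrite H// inE ys orbT.
Qed.

Lemma cost_ge0 (R : realType) (s : seq R) (x : R) : (0 <= cost s x)%E.
Proof. by apply: cost_ge => a _; rewrite lee_fin sqr_ge0. Qed.

Lemma cost_le (R : realType) (s : seq R) (x a : R) :
  a \in s -> (cost s x <= ((x - a) ^+ 2)%:E)%E.
Proof.
elim: s => // y s IH; rewrite inE cost_cons ge_min => /predU1P[->|/IH ->].
  by rewrite lexx.
by rewrite orbT.
Qed.

Lemma cost_subset (R : realType) (s t : seq R) (x : R) :
  {subset s <= t} -> (cost t x <= cost s x)%E.
Proof. by move=> st; apply: cost_ge => a /st; exact: cost_le. Qed.

Lemma measurable_cost (R : realType) (s : seq R) :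
  measurable_fun [set: measurableTypeR R] (cost s).
Proof.
elim: s => [|a s IH].
  by rewrite (_ : cost _ = cst +oo%E)//; apply/funext => x; rewrite /cost big_nil.
rewrite (_ : cost _ = fun x => mine ((x - a) ^+ 2)%:E (cost s x)); last first.
  by apply/funext => x; rewrite cost_cons.
apply: measurable_mine => //; apply/measurable_EFinP.
by apply: measurable_funX; exact: measurable_funB.
Qed.

Lemma cost_affine (R : realType) (r b : R) (s : seq R) (x : R) : r != 0 ->
  cost (map (affine r b) s) (affine r b x) = ((r ^+ 2)%:E * cost s x)%E.
Proof.
move=> r0; have r2 : 0 < r ^+ 2 by rewrite exprn_even_gt0.
elim: s => [|a s IH]; first by rewrite /cost !big_nil mulry gtr0_sg ?mul1e.
rewrite /= !cost_cons IH mine_pMr ?lee_fin ?ltW//; congr mine.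
by rewrite -EFinM; congr EFin; rewrite /affine; ring.
Qed.

Definition mean_cost (R : realType) (Q : borel_probability R) (s : seq R) :
  \bar R := (\int[Q]_x cost s x)%E.

Lemma mean_cost_ge0 (R : realType) (Q : borel_probability R) (s : seq R) :
  (0 <= mean_cost Q s)%E.
Proof. by apply: integral_ge0 => x _; exact: cost_ge0. Qed.

Lemma mean_cost_subset (R : realType) (Q : borel_probability R)
    (s t : seq R) : {subset s <= t} -> (mean_cost Q t <= mean_cost Q s)%E.
Proof.
move=> st; apply: ge0_le_integral => //;
  by [exact: measurable_cost|move=> x _; exact: cost_ge0
     |move=> x _; exact: cost_subset].
Qed.

Definition affine_inv (R : realType) (r b x : R) : R := r^-1 * (x - b).

Lemma map_affine_inv (R : realType) (r b : R) (s : seq R) : r != 0 ->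
  map (affine r b) (map (affine_inv r b) s) = s.
Proof.
move=> r0; rewrite -map_comp; apply: map_id_in => x _ /=.
by rewrite /affine /affine_inv mulVKf// subrK.
Qed.

Lemma integral_cost_affine (R : realType) (Q : borel_probability R) (r b : R)
    (s : seq R) : r != 0 ->
  (\int[Q]_x cost s (affine r b x) =
   (r ^+ 2)%:E * mean_cost Q (map (affine_inv r b) s))%E.
Proof.
move=> r0; rewrite /mean_cost -ge0_integralZl//; first last.
- by rewrite lee_fin sqr_ge0.
- by move=> x _; exact: cost_ge0.
- exact: measurable_cost.
by apply: eq_integral => x _; rewrite -(@cost_affine _ r b)// map_affine_inv.
Qed.

(** Pulling the points back through each map rescales squared distances by [r^2]. Both halves keep
    all the points, hence an equality. *)
Lemma mean_cost_self_similar (R : realType) (Q : borel_probability R)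
    (r b c : R) (s : seq R) : r != 0 ->
  self_similar (affine r b) (affine r c) Q ->
  mean_cost Q s = ((r ^+ 2 / 2)%:E * (mean_cost Q (map (affine_inv r b) s)
                                    + mean_cost Q (map (affine_inv r c) s)))%E.
Proof.
move=> r0 h; set u := mean_cost Q (map _ s); set v := mean_cost Q (map _ s).
rewrite (@ge0_muleDr _ _ u v) ?mean_cost_ge0//.
rewrite [LHS](self_similar_integral h); first last.
- exact: cost_ge0.
- exact: measurable_cost.
by rewrite !integral_cost_affine// !muleA -!EFinM mulrC.
Qed.

(** Pulling the union back through either map recovers [s] and possibly other points, and extra
    points only lower the cost. *)
Lemma mean_cost_refine (R : realType) (Q : borel_probability R)
    (r b c : R) (s : seq R) : r != 0 ->
  self_similar (affine r b) (affine r c) Q ->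
  (mean_cost Q (map (affine r b) s ++ map (affine r c) s)
   <= (r ^+ 2)%:E * mean_cost Q s)%E.
Proof.
move=> r0 h; rewrite (mean_cost_self_similar _ r0 h).
have sub d : d = b \/ d = c ->
    (mean_cost Q (map (affine_inv r d)
      (map (affine r b) s ++ map (affine r c) s)) <= mean_cost Q s)%E.
  have K : map (affine_inv r d) (map (affine r d) s) = s.
    rewrite -map_comp; apply: map_id_in => x _ /=.
    by rewrite /affine /affine_inv addrK mulKf.
  move=> bc; apply: mean_cost_subset => x; rewrite -{1}K map_cat mem_cat.
  by case: bc => <- ->//; rewrite orbT.
have := leeD (sub b (or_introl erefl)) (sub c (or_intror erefl)).
have p : (0 <= (r ^+ 2 / 2)%:E)%E by rewrite lee_fin divr_ge0// sqr_ge0.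
move=> /(lee_wpmul2l p) /le_trans; apply.
rewrite ge0_muleDr ?mean_cost_ge0// -ge0_muleDl// -EFinD.
by rewrite -splitr.
Qed.

(** Refining [[:: x0]] [k] times lists the images of [x0] under all words of length [k]. *)
Lemma mean_cost_upper (R : realType) (Q : borel_probability R)
    (r b c x0 : R) (k : nat) : r != 0 ->
  self_similar (affine r b) (affine r c) Q ->
  exists2 s : seq R, size s = (2 ^ k)%N &
    (mean_cost Q s <= ((r ^+ 2) ^+ k)%:E * mean_cost Q [:: x0])%E.
Proof.
move=> r0 h; elim: k => [|k [s ss Hs]].
  by exists [:: x0]; rewrite ?expr0 ?mul1e.
exists (map (affine r b) s ++ map (affine r c) s).
  by rewrite size_cat !size_map ss addnn expnS mul2n.
apply: (le_trans (mean_cost_refine _ r0 h)).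
rewrite [_ ^+ k.+1]exprS (EFinM (r ^+ 2)) -muleA; apply: lee_wpmul2l => //.
by rewrite lee_fin sqr_ge0.
Qed.

Lemma cost1 (R : realType) (a x : R) : cost [:: a] x = ((x - a) ^+ 2)%:E.
Proof. by rewrite cost_cons /cost big_nil min_l ?leey. Qed.

(** * Almost-sure bounds, and the variance of the Cantor distribution *)

Lemma ae_imply (R : realType) (Q : borel_probability R)
    (A B : measurableTypeR R -> Prop) :
  {ae Q, forall x, A x} -> (forall x, A x -> B x) -> {ae Q, forall x, B x}.
Proof.
by move=> + AB; apply: negligibleS => x /=; apply: contra_not; exact: AB.
Qed.

Lemma integral_ge_ae (R : realType) (Q : borel_probability R) (d : R)
    (F : measurableTypeR R -> \bar R) :
  measurable_fun [set: measurableTypeR R] F -> (forall x, 0 <= F x)%E ->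
  0 <= d -> {ae Q, forall x, (d%:E <= F x)%E} -> (d%:E <= \int[Q]_x F x)%E.
Proof.
move=> mF F0 d0 h.
rewrite -[leLHS]mule1 -(@probability_setT _ _ _ Q) -integral_cst//.
apply: ae_ge0_le_integral => //.
exact: (ae_imply h (fun x hx _ => hx)).
Qed.

Lemma mean_cost1_le (R : realType) (Q : borel_probability R) (a M : R) :
  {ae Q, forall x, (x - a) ^+ 2 <= M} -> 0 <= M ->
  (mean_cost Q [:: a] <= M%:E)%E.
Proof.
move=> h M0; rewrite -[leRHS]mule1 -(@probability_setT _ _ _ Q) -integral_cst//.
apply: ae_ge0_le_integral => //.
- by move=> x _; exact: cost_ge0.
- exact: measurable_cost.
apply: (ae_imply h (B := fun x => setT x -> (cost [:: a] x <= M%:E)%E)).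
by move=> x hx _; rewrite cost1 lee_fin.
Qed.

(* The maps send [1/6 + u] to [1/6 + (u/3 - 1/9)] and [1/6 + (u/3 + 1/9)], so
   the cross terms of the two squares cancel. *)
Lemma cantor_variance (R : realType) (Q : borel_probability R) :
  self_similar (affine 3^-1 0) (affine 3^-1 (2 / 9)) Q ->
  {ae Q, forall x, 0 <= x <= 3^-1} ->
  mean_cost Q [:: 6^-1%R] = (72^-1)%:E.
Proof.
(* The equation [v = v / 9 + 1 / 81] derived below also holds at [+oo], so finiteness is secured
   first. *)
move=> h supp; have vfin : (mean_cost Q [:: 6^-1%R] <= 1%:E)%E.
  by apply: mean_cost1_le => //; apply: (ae_imply supp) => x /andP[? ?]; nra.
have e : mean_cost Q [:: 6^-1%R] =
    ((9^-1)%:E * mean_cost Q [:: 6^-1%R] + (81^-1)%:E)%E.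
  rewrite [LHS](self_similar_integral h); first last.
  - exact: cost_ge0.
  - exact: measurable_cost.
  have mS d : measurable_fun [set: measurableTypeR R]
      (fun x => cost [:: 6^-1%R] (affine 3^-1 d x)).
    by apply: (measurableT_comp (measurable_cost _)); exact: measurable_affine.
  rewrite -!ge0_integralZl//; try by [move=> x _; exact: cost_ge0
    |exact: measurable_cost|rewrite lee_fin invr_ge0].
  rewrite -ge0_integralD//; try by [
    move=> x _; rewrite mule_ge0 ?cost_ge0// lee_fin invr_ge0
    |exact: measurable_funeM].
  rewrite -[X in _ = (_ + X)%E]mule1 -(@probability_setT _ _ _ Q).
  rewrite -integral_cst// -ge0_integralD//; try by [
    move=> x _; rewrite mule_ge0 ?cost_ge0// lee_fin invr_ge0
    |apply: measurable_funeM; exact: measurable_cost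
    |move=> x _; rewrite lee_fin invr_ge0].
  apply: eq_integral => x _; rewrite !cost1 -!EFinM -!EFinD; congr EFin.
  by rewrite /affine; field.
have vf : mean_cost Q [:: 6^-1%R] \is a fin_num.
  by rewrite ge0_fin_numE ?mean_cost_ge0// (le_lt_trans vfin)// ltry.
move: e; rewrite -(fineK vf) -EFinM -EFinD => E.
by congr EFin; have := EFin_inj E; move: (fine _) => v e; lra.
Qed.

(** * Lower bound for the mean cost under the Cantor distribution *)

(** The four intervals are the images of [[0, 1/3]] under the words of length two, each of weight
    [1/4]. *)
Lemma cantor_integral_cells (R : realType) (Q : borel_probability R)
    (d1 d2 d3 d4 : R) (F : measurableTypeR R -> \bar R) :
  self_similar (affine 3^-1 0) (affine 3^-1 (2 / 9)) Q ->
  {ae Q, forall x, 0 <= x <= 3^-1} ->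
  measurable_fun [set: measurableTypeR R] F -> (forall x, 0 <= F x)%E ->
  [/\ 0 <= d1, 0 <= d2, 0 <= d3 & 0 <= d4] ->
  (forall x, 0 <= x <= 27^-1 -> (d1%:E <= F x)%E) ->
  (forall x, 2 / 27 <= x <= 9^-1 -> (d2%:E <= F x)%E) ->
  (forall x, 2 / 9 <= x <= 7 / 27 -> (d3%:E <= F x)%E) ->
  (forall x, 8 / 27 <= x <= 3^-1 -> (d4%:E <= F x)%E) ->
  (((d1 + d2 + d3 + d4) / 4)%:E <= \int[Q]_x F x)%E.
Proof.
move=> h supp mF F0 [d10 d20 d30 d40] H1 H2 H3 H4.
have mS c (G : measurableTypeR R -> \bar R) :
    measurable_fun [set: measurableTypeR R] G ->
    measurable_fun [set: measurableTypeR R] (fun x => G (affine 3^-1 c x)).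
  by move=> mG; apply: (measurableT_comp mG); exact: measurable_affine.
have cell b c d lo hi : 0 <= d ->
    (forall x, lo <= x <= hi -> (d%:E <= F x)%E) ->
    b / 3 + c = lo -> 27^-1 + b / 3 + c = hi ->
    (d%:E <= \int[Q]_x F (affine 3^-1 c (affine 3^-1 b x)))%E.
  move=> d0 H lo_ hi_; apply: integral_ge_ae => //.
    by apply: (mS b (fun x => F (affine 3^-1 c x))); exact: mS.
  apply: (ae_imply supp) => x /andP[? ?]; apply: H.
  by rewrite -lo_ -hi_ /affine; apply/andP; split; lra.
rewrite (self_similar_integral h)//.
rewrite (self_similar_integral (F := fun x => F (affine 3^-1 0 x)) h)//;
  last exact: mS.
rewrite (self_similar_integral (F := fun x => F (affine 3^-1 (2 / 9) x)) h)//;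
  last exact: mS.
have J1 : (d1%:E <= \int[Q]_x F (affine 3^-1 0 (affine 3^-1 0 x)))%E.
  by apply: (cell _ _ _ _ _ d10 H1); lra.
have J2 : (d2%:E <= \int[Q]_x F (affine 3^-1 0 (affine 3^-1 (2 / 9) x)))%E.
  by apply: (cell _ _ _ _ _ d20 H2); lra.
have J3 : (d3%:E <= \int[Q]_x F (affine 3^-1 (2 / 9) (affine 3^-1 0 x)))%E.
  by apply: (cell _ _ _ _ _ d30 H3); lra.
have J4 : (d4%:E <=
    \int[Q]_x F (affine 3^-1 (2 / 9) (affine 3^-1 (2 / 9) x)))%E.
  by apply: (cell _ _ _ _ _ d40 H4); lra.
have half0 : (0 <= (2^-1)%:E :> \bar R)%E by rewrite lee_fin invr_ge0.
apply: le_trans (leeD (lee_wpmul2l half0 (leeD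
    (lee_wpmul2l half0 J1) (lee_wpmul2l half0 J2)))
  (lee_wpmul2l half0 (leeD
    (lee_wpmul2l half0 J3) (lee_wpmul2l half0 J4)))).
by rewrite -?EFinM -?EFinD -?EFinM -?EFinD lee_fin; lra.
Qed.

(* Lengths below are in units of [1/54]: the four second-level intervals of the
   Cantor set are [0,2], [4,6], [12,14], [16,18], and squared distances are
   capped at [9^2]. The worst single point is the centre [9], with
   [7^2 + 3^2 + 3^2 + 7^2 = 116]. *)
Lemma one_point_bounds (R : realType) (a : R) :
  exists d1 d2 d3 d4 : R,
  [/\ 116 / 2916 <= d1 + d2 + d3 + d4,
    [/\ 0 <= d1 <= 36^-1, 0 <= d2 <= 36^-1,
        0 <= d3 <= 36^-1 & 0 <= d4 <= 36^-1] &
    [/\ forall x, 0 <= x <= 27^-1 -> d1 <= (x - a) ^+ 2,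
        forall x, 2 / 27 <= x <= 9^-1 -> d2 <= (x - a) ^+ 2,
        forall x, 2 / 9 <= x <= 7 / 27 -> d3 <= (x - a) ^+ 2 &
        forall x, 8 / 27 <= x <= 3^-1 -> d4 <= (x - a) ^+ 2]].
Proof.
have sq (u v : R) : 0 <= u -> u <= v \/ u <= - v -> u ^+ 2 <= v ^+ 2.
  by move=> u0 [|] ?; nra.
(* Outside the central case the entries are the least distances over the range of [a], lowered to 9
   when larger; the sums of squares are 145, 121, 122 and their mirror images. *)
have [a4|a4] := lerP a (4 / 54).
  exists 0, 0, ((8 / 54) ^+ 2), ((9 / 54) ^+ 2).
  do 2?split; try lra; try (apply/andP; split; lra); move=> x /andP[? ?];
  rewrite ?sqr_ge0//; apply: sq; lra.
have [a6|a6] := lerP a (6 / 54).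
  exists ((2 / 54) ^+ 2), 0, ((6 / 54) ^+ 2), ((9 / 54) ^+ 2).
  do 2?split; try lra; try (apply/andP; split; lra); move=> x /andP[? ?];
  rewrite ?sqr_ge0//; apply: sq; lra.
have [a7|a7] := lerP a (7 / 54).
  exists ((4 / 54) ^+ 2), 0, ((5 / 54) ^+ 2), ((9 / 54) ^+ 2).
  do 2?split; try lra; try (apply/andP; split; lra); move=> x /andP[? ?];
  rewrite ?sqr_ge0//; apply: sq; lra.
have [a11|a11] := lerP a (11 / 54).
  exists ((a - 2 / 54) ^+ 2), ((a - 6 / 54) ^+ 2), ((12 / 54 - a) ^+ 2),
    ((16 / 54 - a) ^+ 2).
  (* In units of [1/54] the four squares add up to [116 + 4 (a - 9)^2]. *)
  have := sqr_ge0 (a - 9 / 54); rewrite expr2 => ?.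
  do 2?split; try nra; try (apply/andP; split; nra); move=> x /andP[? ?];
  apply: sq; lra.
have [a12|a12] := lerP a (12 / 54).
  exists ((9 / 54) ^+ 2), ((5 / 54) ^+ 2), 0, ((4 / 54) ^+ 2).
  do 2?split; try lra; try (apply/andP; split; lra); move=> x /andP[? ?];
  rewrite ?sqr_ge0//; apply: sq; lra.
have [a14|a14] := lerP a (14 / 54).
  exists ((9 / 54) ^+ 2), ((6 / 54) ^+ 2), 0, ((2 / 54) ^+ 2).
  do 2?split; try lra; try (apply/andP; split; lra); move=> x /andP[? ?];
  rewrite ?sqr_ge0//; apply: sq; lra.
exists ((9 / 54) ^+ 2), ((8 / 54) ^+ 2), 0, 0.
do 2?split; try lra; try (apply/andP; split; lra); move=> x /andP[? ?];
rewrite ?sqr_ge0//; apply: sq; lra.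
Qed.

(* Half-open, so that its images under the two similarities are disjoint; both
   images lie inside it. *)
Definition near_hull (R : realType) : pred R := fun a => - 6^-1 <= a < 2^-1.
Arguments near_hull {R}.

(** With no point in [near_hull] every squared distance is at least [1/36 > 58/2916]; with one, the
    four cells average at least [116/2916/4 = 29/2916]; with two or more the bound is
    nonpositive. *)
Lemma cantor_cost_base (R : realType) (Q : borel_probability R) (s : seq R) :
  self_similar (affine 3^-1 0) (affine 3^-1 (2 / 9)) Q ->
  {ae Q, forall x, 0 <= x <= 3^-1} ->
  ((29 / 2916 * (2 - (count near_hull s)%:R))%:E <= mean_cost Q s)%E.
Proof.
move=> h supp.
have far (a x : R) : ~~ near_hull a -> 0 <= x <= 3^-1 -> 36^-1 <= (x - a) ^+ 2.
  rewrite negb_and -ltNge -leNgt => /orP[H|H] /andP[? ?]; nra.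
case E : (count near_hull s) => [|[|n]].
- apply: (@le_trans _ _ (36^-1)%:E); first by rewrite lee_fin; lra.
  apply: integral_ge_ae => //; first exact: measurable_cost.
    by move=> x; exact: cost_ge0.
  apply: (ae_imply supp) => x hx; apply: cost_ge => a sa; rewrite lee_fin.
  apply: far => //; move/eqP: E; rewrite -leqn0 leqNgt -has_count => /hasPn.
  exact.
- have /hasP[a0 a0s Na0] : has near_hull s by rewrite has_count E.
  have uniq_near a : a \in s -> near_hull a -> a = a0.
    move=> sa Na; apply/eqP/negPn/negP => aa0.
    move: sa; rewrite (perm_mem (perm_to_rem a0s)) inE (negbTE aa0)/= => sa.
    have := permP (perm_to_rem a0s) near_hull; rewrite E/= Na0 => -[] /esym.
    by move/eqP; rewrite -leqn0 leqNgt -has_count => /hasPn/(_ _ sa); rewrite Na.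
  have [d1 [d2 [d3 [d4 [D [D1 D2 D3 D4] [H1 H2 H3 H4]]]]]] :=
    one_point_bounds a0.
  apply: (@le_trans _ _ ((d1 + d2 + d3 + d4) / 4)%:E).
    by rewrite lee_fin; lra.
  (* The cap [36^-1] pays off here: all points other than [a0] lie outside [near_hull], so a capped
     bound for [a0] holds for the whole of [s]. *)
  have key d x : d <= 36^-1 -> d <= (x - a0) ^+ 2 -> 0 <= x <= 3^-1 ->
      (d%:E <= cost s x)%E.
    move=> ? ? ?; apply: cost_ge => a sa; rewrite lee_fin.
    have [Na|Na] := boolP (near_hull a); first by rewrite (uniq_near a sa Na).
    exact/(@le_trans _ _ 36^-1)/far.
  move: D1 D2 D3 D4 => /andP[? ?] /andP[? ?] /andP[? ?] /andP[? ?].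
  apply: cantor_integral_cells => //;
    [exact: measurable_cost|exact: cost_ge0|..]; move=> x xc; apply: key;
    rewrite ?H1 ?H2 ?H3 ?H4//;
    by case/andP: xc => ? ?; apply/andP; split; lra.
- apply: (@le_trans _ _ (0%:E : \bar R)); last exact: mean_cost_ge0.
  by rewrite lee_fin -natr1 -natr1; have := ler0n R n; lra.
Qed.

(** By induction on [k]: the bound is affine in the count, so the bounds for the two halves add up
    to the next one however the points are shared between them. *)
Lemma cantor_cost_lower (R : realType) (Q : borel_probability R) (k : nat)
    (s : seq R) :
  self_similar (affine 3^-1 0) (affine 3^-1 (2 / 9)) Q ->
  {ae Q, forall x, 0 <= x <= 3^-1} ->
  ((29 / 2916 / 9 ^+ k * (2 - (count near_hull s)%:R / 2 ^+ k))%:E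
   <= mean_cost Q s)%E.
Proof.
move=> h supp; elim: k s => [|k IH] s.
  by rewrite !expr0 !divr1; exact: cantor_cost_base.
have i30 : 3^-1 != 0 :> R by [].
rewrite (mean_cost_self_similar _ i30 h).
set s1 := map _ s; set s2 := map _ s.
(* A point is counted in [s1] when it lies in [[-1/18, 1/6)] and in [s2] when it lies in
   [[1/6, 7/18)]; these intervals abut at [1/6]. *)
have cnt : (count near_hull s1 + count near_hull s2 <= count near_hull s)%N.
  rewrite !count_map -count_predUI [X in (_ + X)%N](@eq_count _ _ pred0).
    rewrite count_pred0 addn0; apply: sub_count => x /=.
    by rewrite /near_hull /affine_inv => /orP[] /andP[? ?];
      apply/andP; split; lra.
  move=> x /=; apply/negbTE/negP; rewrite /near_hull /affine_inv.
  by move=> /andP[/andP[? ?] /andP[? ?]]; lra.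
have p : (0 <= (3^-1 ^+ 2 / 2 : R)%:E)%E by rewrite lee_fin; nra.
apply: le_trans (lee_wpmul2l p (leeD (IH s1) (IH s2))).
rewrite -EFinD -EFinM lee_fin.
have {}cnt : (count near_hull s1)%:R + (count near_hull s2)%:R
    <= (count near_hull s)%:R :> R by rewrite -natrD ler_nat.
move: cnt; set n1 := _%:R; set n2 := _%:R; set n := _%:R => cnt.
have p9 : 0 < (9 ^+ k)^-1 :> R by rewrite invr_gt0 exprn_gt0.
have p2 : 0 < (2 ^+ k)^-1 :> R by rewrite invr_gt0 exprn_gt0.
rewrite !exprS !invfM; set u := _^-1 in p9 *; set v := _^-1 in p2 *.
have : (n1 + n2) * v <= n * v by rewrite ler_wpM2r// ltW.
move=> H; have : 0 <= u * (n * v - (n1 + n2) * v).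
  by rewrite mulr_ge0 ?subr_ge0// ltW.
by move=> *; lra.
Qed.

(** * The normalizing power of the number of points *)

(** This is [2 / beta1], the exponent [e] with [2^e = 9]. *)
Definition cantor_exponent (R : realType) : R := 2 / (ln 2 / ln 3).
Arguments cantor_exponent {R}.

Definition cantor_scale (R : realType) (n : nat) : R :=
  n%:R `^ cantor_exponent.
Arguments cantor_scale {R}.

Lemma ln2_gt0 (R : realType) : 0 < ln 2 :> R.
Proof. by rewrite ln_gt0// ltr1n. Qed.

Lemma ln3_gt0 (R : realType) : 0 < ln 3 :> R.
Proof. by rewrite ln_gt0// ltr1n. Qed.

Lemma ln3_le_2ln2 (R : realType) : ln 3 <= 2 * ln 2 :> R.
Proof.
by rewrite mulr_natl -lnXn// ler_ln ?posrE ?exprn_gt0// -natrX ler_nat.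
Qed.

(** From [2^3 <= 3^2]; it makes the exponent at least 3, whence [27 <= cantor_scale 3]. *)
Lemma ln2_le_2ln3 (R : realType) : 3 * ln 2 <= 2 * ln 3 :> R.
Proof.
by rewrite !mulr_natl -!lnXn// ler_ln ?posrE ?exprn_gt0// -!natrX ler_nat.
Qed.

Lemma cantor_exponentE (R : realType) :
  cantor_exponent * ln 2 = 2 * ln 3 :> R.
Proof.
by rewrite /cantor_exponent invf_div mulrA divfK// gt_eqF// ln2_gt0.
Qed.

Lemma cantor_exponent_gt0 (R : realType) : 0 < cantor_exponent :> R.
Proof. by rewrite !divr_gt0// ?ln2_gt0 ?ln3_gt0. Qed.

Lemma cantor_exponent_le4 (R : realType) : cantor_exponent <= 4 :> R.
Proof.
rewrite -(ler_pM2r (ln2_gt0 R)) cantor_exponentE.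
by have := ln3_le_2ln2 R; lra.
Qed.

Lemma cantor_scaleM (R : realType) (m n : nat) :
  cantor_scale (m * n) = cantor_scale m * cantor_scale n :> R.
Proof. by rewrite /cantor_scale natrM powRM. Qed.

Lemma cantor_scale2 (R : realType) : cantor_scale 2 = 9 :> R.
Proof.
rewrite /cantor_scale /powR pnatr_eq0/= cantor_exponentE.
by rewrite mulr_natl -lnXn// lnK ?posrE ?exprn_gt0// -natrX.
Qed.

Lemma cantor_scale2X (R : realType) (k : nat) :
  cantor_scale (2 ^ k) = 9 ^+ k :> R.
Proof.
elim: k => [|k IH]; first by rewrite /cantor_scale powR1.
by rewrite expnS cantor_scaleM IH cantor_scale2 exprS.
Qed.

Lemma cantor_scale3 (R : realType) : 27 <= cantor_scale 3 :> R.
Proof.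
rewrite /cantor_scale /powR pnatr_eq0/= -[leLHS]lnK ?posrE// ler_expR.
have -> : (27 : R) = 3 ^+ 3 by rewrite -natrX.
rewrite lnXn// -[ln 3 *+ 3]mulr_natl ler_pM2r ?ln3_gt0//.
rewrite -(ler_pM2r (ln2_gt0 R)) cantor_exponentE.
exact: ln2_le_2ln3.
Qed.

Lemma cantor_scale_le (R : realType) (m n : nat) :
  (m <= n)%N -> cantor_scale m <= cantor_scale n :> R.
Proof.
move=> mn; apply: ge0_ler_powR; rewrite ?nnegrE ?ler_nat//.
exact/ltW/cantor_exponent_gt0.
Qed.

(** * Consequences of the two-sided bounds for a real sequence *)

Section cantor_rate.
Variables (R : realType) (V : nat -> R).

(** In the bounds, [29/5832] is half of [29/2916], by the weight of [P1]; [1/72] is the variance of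
    [P1], and [1/9] and [1/16] are the squared contraction ratios. *)
Hypothesis V_lower : forall n k, (2 <= n)%N ->
  29 / 5832 / 9 ^+ k * (2 - n%:R / 2 ^+ k) <= V n.

Hypothesis V_upper : forall n k j, (2 ^ k + 2 ^ j <= n)%N ->
  V n <= ((72 * 9 ^+ k)^-1 + (16 ^+ j)^-1) / 2.

(** Choosing [2^(k-1) < n <= 2^k] makes [2 - n / 2^k] at least 1, and the scale at [n] is at least
    [9^(k-1)]. *)
Lemma scale_V_lower n : (2 <= n)%N -> 29 / (5832 * 9) <= cantor_scale n * V n.
Proof.
move=> n2; have /andP[k1 k2] := up_log_bounds (ltnSn 1) n2.
set k := up_log 2 n in k1 k2.
have k0 : (0 < k)%N by rewrite up_log_gt0.
have le9 : 9 ^+ k <= 9 * cantor_scale n :> R.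
  rewrite -cantor_scale2X -[X in X * _]cantor_scale2 -cantor_scaleM.
  by apply: cantor_scale_le; rewrite -(prednK k0) expnS leq_mul2l ltnW.
have nk : n%:R / 2 ^+ k <= 1 :> R.
  by rewrite ler_pdivrMr ?exprn_gt0// mul1r -natrX ler_nat.
have k9 : 0 < (9 ^+ k)^-1 :> R by rewrite invr_gt0 exprn_gt0.
have W0 : 0 <= cantor_scale n :> R by exact: powR_ge0.
have k9E : (9 ^+ k)^-1 * 9 ^+ k = 1 :> R by rewrite mulVf// gt_eqF// exprn_gt0.
have := V_lower k n2; move: nk; set u := _ / _ ^+ _; set v := _^-1 in k9 k9E *.
move=> u1 HV; have : 29 / 5832 * v <= V n by nra.
by move: le9 k9E; set w := 9 ^+ k => *; nra.
Qed.

(** Choosing [2^(k+1) <= n < 2^(k+2)] affords [2^k] points for each component, and the scale is at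
    most [9^(k+2)]. *)
Lemma scale_V_upper n : (2 <= n)%N -> cantor_scale n * V n <= 81.
Proof.
move=> n2; have /andP[k1 k2] := trunc_log_bounds (ltnSn 1) (ltnW n2).
set t := trunc_log 2 n in k1 k2.
have t0 : (0 < t)%N by rewrite trunc_log_gt0.
case: t => // k in k1 k2 t0 *.
have kn : (2 ^ k + 2 ^ k <= n)%N by rewrite addnn -mul2n -expnS.
have le9 : cantor_scale n <= 81 * 9 ^+ k :> R.
  apply: (le_trans (cantor_scale_le R (ltnW k2))).
  by rewrite cantor_scale2X !exprS mulrA -natrM.
have k9 : 0 < (9 ^+ k)^-1 :> R by rewrite invr_gt0 exprn_gt0.
have k16 : (16 ^+ k)^-1 <= (9 ^+ k)^-1 :> R.
  by rewrite lef_pV2 ?posrE ?exprn_gt0// lerXn2r ?nnegrE// ler_nat.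
have k9E : (9 ^+ k)^-1 * 9 ^+ k = 1 :> R by rewrite mulVf// gt_eqF// exprn_gt0.
have W0 : 0 <= cantor_scale n :> R by exact: powR_ge0.
have := V_upper kn; rewrite invfM; set v := (9 ^+ k)^-1 in k9 k9E k16 *.
move=> HV; have : V n <= v by lra.
by move: le9 k9E; set w := 9 ^+ k => *; nra.
Qed.

(** With [e] the exponent, [e ln n + ln V_n] stays bounded, so [- ln V_n / (2 ln n)] tends to
    [e / 2]; the dimension is the reciprocal. *)
Lemma V_dimension :
  (fun n : nat => 2 * ln n%:R / - ln (V n)) @ \oo --> (ln 2 / ln 3 : R).
Proof.
pose e : R := cantor_exponent.
have be : ln 2 / ln 3 = (e / 2)^-1 :> R.
  by rewrite /e /cantor_exponent; field; rewrite !gt_eqF ?ln2_gt0 ?ln3_gt0.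
rewrite be.
rewrite (_ : (fun n => _) = (fun n => ((- ln (V n)) / (2 * ln n%:R))^-1));
  last by apply/funext => n; rewrite invf_div.
apply: cvgV; first by rewrite gt_eqF// divr_gt0// cantor_exponent_gt0.
have [c c0 Vc] : exists2 c : R, 0 < c &
    forall n, (2 <= n)%N -> c <= cantor_scale n * V n.
  by exists (29 / (5832 * 9)); [lra|exact: scale_V_lower].
pose K : R := `|ln c| + `|ln 81|.
have bound n : (2 <= n)%N -> `|e * ln n%:R + ln (V n)| <= K.
  move=> n2; have := Vc n n2; have := scale_V_upper n2.
  have n0 : 0 < n%:R :> R by rewrite ltr0n ltnW.
  have W0 : 0 < cantor_scale n :> R by rewrite powR_gt0.
  move=> U L; have V0 : 0 < V n.
    by rewrite -(pmulr_rgt0 _ W0) (lt_le_trans _ L).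
  rewrite -ler_ln ?posrE ?mulr_gt0// in U.
  rewrite -ler_ln ?posrE ?mulr_gt0// in L.
  rewrite lnM ?posrE// ln_powR in U L.
  rewrite ler_norml /K.
  have := ler_norm (ln (81 : R)); have := normr_ge0 (ln (81 : R)).
  have := ler_norm (- ln c).
  have := normr_ge0 (ln c); rewrite normrN.
  by move=> *; apply/andP; split; rewrite /e; lra.
have K0 : 0 <= K by rewrite addr_ge0.
apply/cvgrPdist_le => eps eps0; near=> n.
have n2 : (2 <= n)%N by near: n; exact: nbhs_infty_ge.
have n0 : 0 < n%:R :> R by rewrite ltr0n ltnW.
have ln0 : 0 < ln n%:R :> R by rewrite ln_gt0// ltr1n.
have big : K / (2 * eps) <= ln n%:R.
  rewrite -[leLHS]expRK ler_ln ?posrE ?expR_gt0//.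
  by near: n; exact: nbhs_infty_ger.
rewrite (_ : _ - _ = (e * ln n%:R + ln (V n)) / (2 * ln n%:R)); last first.
  by field; rewrite gt_eqF.
rewrite normrM [X in _ * X]ger0_norm ?invr_ge0 ?mulr_ge0// ?(ltW ln0)//.
rewrite ler_pdivrMr ?mulr_gt0//; apply: (le_trans (bound n n2)).
by move: big; rewrite ler_pdivrMr ?mulr_gt0//; lra.
Unshelve. all: by end_near.
Qed.

(* Below [n = 2^(10 i) + 2^(9 i)]: all but a negligible proportion of the points
   go to the first component, and [9^10 <= 16^9 / 2] makes the error of the
   second one negligible. *)
Lemma scale_V_small i : (17 <= i)%N ->
  cantor_scale (2 ^ (10 * i) + 2 ^ (9 * i)) * V (2 ^ (10 * i) + 2 ^ (9 * i))
    <= 140^-1.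
Proof.
(* [x] is the ratio [2^(9 i) / 2^(10 i)] and also dominates the scaled error of the second
   component. The final bound [(1 + 5 x)(1/72 + x) / 2] tends to [1/144], and [x <= 2^-17] amply
   brings it below [1/140]. *)
move=> i17; pose x : R := (2 ^+ i)^-1.
have i0 : 0 < 2 ^+ i :> R by rewrite exprn_gt0.
have x0 : 0 < x by rewrite invr_gt0.
have e17 : 2 ^+ 17 = 1024 * 128 :> R by ring.
have : 1024 * 128 <= 2 ^+ i :> R by rewrite -e17 ler_eXn2l ?ltr1n.
move=> /(ler_wpM2l (ltW x0)); rewrite {2}/x mulVf ?gt_eqF// => x1.
have V1 := V_upper (leqnn (2 ^ (10 * i) + 2 ^ (9 * i))).
have W1 : cantor_scale (2 ^ (10 * i) + 2 ^ (9 * i))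
    <= 9 ^+ (10 * i) * (1 + x) ^+ 4 :> R.
  rewrite -cantor_scale2X /cantor_scale -[_ ^+ 4]powR_mulrn; last lra.
  rewrite (_ : (_ + _)%:R = (2 ^ (10 * i))%:R * (1 + x)); last first.
    rewrite natrD !natrX mulrDr mulr1; congr (_ + _).
    by rewrite /x (mulSnr 9 i) exprD mulfK// gt_eqF.
  rewrite powRM//; last lra.
  rewrite ler_wpM2l ?powR_ge0//; apply: ler_powR; first lra.
  exact: cantor_exponent_le4.
have q : 9 ^+ (10 * i) / 16 ^+ (9 * i) <= x.
  rewrite !exprM -expr_div_n /x -exprVn; apply: lerXn2r.
  - by rewrite nnegrE divr_ge0// exprn_ge0.
  - by rewrite nnegrE.
  by rewrite ler_pdivrMr ?exprn_gt0//; lra.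
have w0 : 0 < 9 ^+ (10 * i) :> R by rewrite exprn_gt0.
set W := cantor_scale _ in W1 *; have W0 : 0 <= W by exact: powR_ge0.
apply: (le_trans (ler_wpM2l W0 V1)).
have s0 : 0 <= ((72 * 9 ^+ (10 * i))^-1 + (16 ^+ (9 * i))^-1) / 2 :> R.
  by rewrite divr_ge0// addr_ge0// invr_ge0 ?mulr_ge0// exprn_ge0.
apply: (le_trans (ler_wpM2r s0 W1)).
move: q; set z := (16 ^+ _)^-1; set w := 9 ^+ _ in w0 *.
move=> q; rewrite [leLHS](_ : _ = (1 + x) ^+ 4 * (72^-1 + w * z) / 2); last first.
  by field; rewrite gt_eqF.
have x4 : (1 + x) ^+ 4 <= 1 + 5 * x by nra.
have p0 : 0 <= 72^-1 + x by lra.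
have p4 : 0 <= (1 + x) ^+ 4 by rewrite exprn_ge0//; lra.
have : (1 + x) ^+ 4 * (72^-1 + w * z) <= (1 + x) ^+ 4 * (72^-1 + x).
  by rewrite ler_wpM2l// lerD2l.
have := ler_wpM2r p0 x4.
by move=> *; nra.
Qed.

(** At level [k + 1] the factor [2 - n / 2^(k+1)] is [1/2], leaving
    [27/9 * 29/5832 / 2 = 29/3888 > 1/135]. *)
Lemma scale_V_large k : 135^-1 <= cantor_scale (3 * 2 ^ k) * V (3 * 2 ^ k).
Proof.
have n2 : (2 <= 3 * 2 ^ k)%N.
  by apply: (@leq_trans 3) => //; rewrite leq_pmulr// expn_gt0.
have := V_lower k.+1 n2.
rewrite (_ : (3 * 2 ^ k)%:R / _ = 3 / 2 :> R); last first.
  by rewrite natrM natrX exprS; field; rewrite gt_eqF// exprn_gt0.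
rewrite cantor_scaleM cantor_scale2X => VL.
have w0 : 0 < 9 ^+ k :> R by rewrite exprn_gt0.
have c3 := cantor_scale3 R.
apply: (@le_trans _ _ (27 * 9 ^+ k * (29 / 5832 / 9 ^+ k.+1 * (2 - 3 / 2)))).
  by rewrite exprS invfM; set w := _ ^+ _ in w0 *; rewrite (_ : 27 * _ * _ =
    27 * 29 / 5832 / 18); [lra|field; rewrite gt_eqF].
apply: ler_pM VL.
- by apply: mulr_ge0; [lra|exact: ltW].
- by apply: mulr_ge0; [apply: divr_ge0; [lra|rewrite exprn_ge0]|lra].
by rewrite ler_wpM2r// ltW.
Qed.

End cantor_rate.

(** * Lower and upper limits, and the error bounds for the mixture *)

Lemma limn_einf_le_frequently (R : realType) (u : (\bar R)^nat) (c : \bar R) :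
  (forall n, exists2 k, (n <= k)%N & (u k <= c)%E) -> (limn_einf u <= c)%E.
Proof.
move=> H; rewrite limn_einf_lim; apply: lime_le; first exact: is_cvg_einfs.
apply: nearW => n; have [k nk uk] := H n.
by apply: ge_ereal_inf; exists (u k) => //; exists k.
Qed.

Lemma limn_esup_ge_frequently (R : realType) (u : (\bar R)^nat) (c : \bar R) :
  (forall n, exists2 k, (n <= k)%N & (c <= u k)%E) -> (c <= limn_esup u)%E.
Proof.
move=> H; rewrite limn_esup_lim; apply: lime_ge; first exact: is_cvg_esups.
apply: nearW => n; have [k nk uk] := H n.
by apply: (le_trans uk); apply: ereal_sup_ubound; exists k.
Qed.

Lemma mixture_mean_cost (R : realType) (Q Q1 Q2 : borel_probability R)
    (s : seq R) : half_mixture Q Q1 Q2 ->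
  mean_cost Q s = ((2^-1)%:E * mean_cost Q1 s + (2^-1)%:E * mean_cost Q2 s)%E.
Proof.
move=> h; apply: (half_mixture_integral h); last exact: cost_ge0.
exact: measurable_cost.
Qed.

Lemma mixture_error_lower (R : realType) (P1 P2 P : borel_probability R)
    (n k : nat) :
  self_similar (affine 3^-1 0) (affine 3^-1 (2 / 9)) P1 -> half_mixture P P1 P2 ->
  ((29 / 5832 / 9 ^+ k * (2 - n%:R / 2 ^+ k))%:E <= quantization_error P n)%E.
Proof.
move=> h1 h; have supp : {ae P1, forall x, 0 <= x <= 3^-1}.
  by apply: (self_similar_support _ h1); rewrite /affine ?mulr0; lra.
apply: le_ereal_inf_tmp => _ [alpha /andP[_ an] <-].
change (distortion P alpha) with (mean_cost P alpha).
rewrite (mixture_mean_cost _ h).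
have half0 : (0 <= (2^-1)%:E :> \bar R)%E by rewrite lee_fin invr_ge0.
apply: le_trans (leeDl _ (mule_ge0 half0 (mean_cost_ge0 P2 _))).
apply: le_trans (lee_wpmul2l half0 (cantor_cost_lower k _ h1 supp)).
rewrite -EFinM lee_fin.
have : (count near_hull alpha)%:R <= n%:R :> R.
  by rewrite ler_nat (leq_trans (count_size _ _)).
have k9 : 0 < (9 ^+ k)^-1 :> R by rewrite invr_gt0 exprn_gt0.
have k2 : 0 < (2 ^+ k)^-1 :> R by rewrite invr_gt0 exprn_gt0.
move: (_ ^-1) (_ ^-1) k9 k2 => u v u0 v0 /(ler_wpM2r (ltW v0)).
by move=> /(lerB (lexx 2))/(ler_wpM2l (ltW u0)); lra.
Qed.

Lemma mixture_error_upper (R : realType) (P1 P2 P : borel_probability R)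
    (n k j : nat) :
  self_similar (affine 3^-1 0) (affine 3^-1 (2 / 9)) P1 ->
  self_similar (affine 4^-1 2^-1) (affine 4^-1 (3 / 4)) P2 ->
  half_mixture P P1 P2 -> (2 ^ k + 2 ^ j <= n)%N ->
  (quantization_error P n <=
   (((72 * 9 ^+ k)^-1 + (16 ^+ j)^-1) / 2)%:E)%E.
Proof.
move=> h1 h2 h kjn.
have supp1 : {ae P1, forall x, 0 <= x <= 3^-1}.
  by apply: (self_similar_support _ h1); rewrite /affine ?mulr0; lra.
(* The endpoints [2/3] and [1] are the fixed points of the two maps. *)
have supp2 : {ae P2, forall x, 2 / 3 <= x <= 1}.
  by apply: (self_similar_support _ h2); rewrite /affine; lra.
have i3 : 3^-1 != 0 :> R by [].
have i4 : 4^-1 != 0 :> R by [].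
(* The mean [1/6] of [P1] yields the exact constant [1/72]; for [P2] only the order [16^-j] matters,
   so the endpoint [1], with cost at most 1, is enough. *)
have [s ss Hs] := mean_cost_upper 6^-1 k i3 h1.
have [t st Ht] := mean_cost_upper 1 j i4 h2.
have c2 : (mean_cost P2 [:: 1%R] <= 1%:E)%E.
  by apply: mean_cost1_le => //; apply: (ae_imply supp2) => x /andP[? ?]; nra.
pose alpha : {fset R} := [fset x in s ++ t]%fset.
have mem_alpha x : (x \in alpha) = (x \in s) || (x \in t).
  by rewrite in_fset /= mem_cat.
apply: ge_ereal_inf; exists (distortion P alpha).
  (* Nonempty since [s] has [2^k > 0] entries; forming the finite set can only merge duplicates, so
     the cardinal is at most [2^k + 2^j]. *)
  exists alpha => //=; apply/andP; split.
    rewrite cardfs_gt0; apply/fset0Pn; exists (head 0 s).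
    rewrite mem_alpha.
    by case: s ss {Hs alpha mem_alpha} => [/esym/eqP|x s _];
      rewrite ?expn_eq0// mem_head.
  apply: leq_trans kjn; rewrite -ss -st -size_cat.
  by rewrite card_fseq size_undup.
change (distortion P alpha) with (mean_cost P alpha).
rewrite (mixture_mean_cost _ h).
have half0 : (0 <= (2^-1)%:E :> \bar R)%E by rewrite lee_fin invr_ge0.
have sub1 : (mean_cost P1 alpha <= mean_cost P1 s)%E.
  apply: mean_cost_subset => x xs.
  by apply: (etrans (mem_alpha x)); rewrite xs ?orbT.
have sub2 : (mean_cost P2 alpha <= mean_cost P2 t)%E.
  apply: mean_cost_subset => x xs.
  by apply: (etrans (mem_alpha x)); rewrite xs ?orbT.
rewrite (cantor_variance h1 supp1) -EFinM in Hs.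
have q0 : (0 <= ((4^-1 ^+ 2) ^+ j)%:E :> \bar R)%E by rewrite lee_fin exprn_ge0.
have {}Ht := le_trans Ht (lee_wpmul2l q0 c2).
apply: (le_trans (leeD (lee_wpmul2l half0 (le_trans sub1 Hs))
  (lee_wpmul2l half0 (le_trans sub2 Ht)))).
rewrite -!EFinM -EFinD lee_fin.
have -> : 3^-1 ^+ 2 = 9^-1 :> R by field.
have -> : 4^-1 ^+ 2 = 16^-1 :> R by field.
by rewrite !exprVn invfM; set u := (_ ^+ _)^-1; set v := (_ ^+ _)^-1; lra.
Qed.

Theorem theorem6p17p2 (R : realType) (P1 P2 P : borel_probability R)
    (hP1 : self_similar (fun x : R => 3^-1 * x)
                        (fun x : R => 3^-1 * x + 2 / 9) P1)
    (hP2 : self_similar (fun x : R => 4^-1 * x + 2^-1)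
                        (fun x : R => 4^-1 * x + 3 / 4) P2)
    (hP : half_mixture P P1 P2) :
  let beta1 : R := ln 2 / ln 3 in
  has_quantization_dimension P beta1 /\
  ~ quantization_coefficient_exists P /\
  ~ cvgn (scaled_quantization_error P beta1).
Proof.
move=> beta1.
have h1 : self_similar (affine 3^-1 0) (affine 3^-1 (2 / 9)) P1.
  rewrite (_ : affine 3^-1 0 = fun x => 3^-1 * x)//.
  by apply/funext => x; rewrite /affine addr0.
pose V n := fine (quantization_error P n).
(* One point per component already gives a finite error, hence the threshold 2. *)
have VE n : (2 <= n)%N -> quantization_error P n = (V n)%:E.
  move=> n2; rewrite fineK// fin_numE -ltey -ltNye; apply/andP; split.
    by rewrite (lt_le_trans _ (mixture_error_lower n 0 h1 hP))// ltNyr.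
  apply: le_lt_trans (mixture_error_upper (k := 0) (j := 0) h1 hP2 hP n2) _.
  exact: ltry.
have VL n k : (2 <= n)%N -> 29 / 5832 / 9 ^+ k * (2 - n%:R / 2 ^+ k) <= V n.
  by move=> n2; rewrite -lee_fin -VE//; exact: mixture_error_lower hP.
have VU n k j : (2 ^ k + 2 ^ j <= n)%N ->
    V n <= ((72 * 9 ^+ k)^-1 + (16 ^+ j)^-1) / 2.
  move=> kjn; rewrite -lee_fin -VE; first exact: (mixture_error_upper h1 hP2 hP).
  by apply: leq_trans kjn; rewrite -[2%N]/(1 + 1)%N leq_add// expn_gt0.
have dim : has_quantization_dimension P beta1 by exact: V_dimension VL VU.
have SE n : (2 <= n)%N ->
    scaled_quantization_error P beta1 n = (cantor_scale n * V n)%:E.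
  by move=> n2; rewrite /scaled_quantization_error VE// -EFinM.
have small : (lower_quantization_coefficient P beta1 <= (140^-1)%:E)%E.
  apply: limn_einf_le_frequently => n.
  pose i := maxn 17 n; pose m := (2 ^ (10 * i) + 2 ^ (9 * i))%N.
  have im : (i <= m)%N.
    apply: (leq_trans (ltnW (ltn_expl i (ltnSn 1)))).
    by apply: leq_trans (leq_addr _ _); rewrite leq_exp2l// leq_pmull.
  exists m; first by apply: leq_trans im; rewrite leq_maxr.
  rewrite SE ?lee_fin; last by apply: leq_trans im; rewrite leq_max.
  by apply: scale_V_small VU _ _; rewrite leq_maxl.
have large : ((135^-1)%:E <= upper_quantization_coefficient P beta1)%E.
  apply: limn_esup_ge_frequently => n; exists (3 * 2 ^ n)%N.
    by rewrite (leq_trans (ltnW (ltn_expl n (ltnSn 1))))// leq_pmull.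
  rewrite SE ?lee_fin; first exact: scale_V_large VL _.
  by apply: (@leq_trans 3) => //; rewrite leq_pmulr// expn_gt0.
have gap : lower_quantization_coefficient P beta1 <>
    upper_quantization_coefficient P beta1.
  move=> e; have := le_trans large; rewrite -e => /(_ _ small).
  by rewrite lee_fin; lra.
split=> //; split.
  (* Uniqueness of the limit forces the dimension [s] to be [beta1]. *)
  move=> [s sdim e]; apply: gap.
  by rewrite (cvg_unique _ dim sdim).
move=> /cvg_ex[l /cvg_limn_einf_sup[e1 e2]]; apply: gap.
by rewrite /lower_quantization_coefficient /upper_quantization_coefficient e1 e2.
Qed.
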